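(* Let $k \ge 1$ be an integer. If $G$ is a connected graph with radius $r$, then \[ \gamma_k(G) \ge \frac{2r}{2k+1}. \]
   Context: All graphs are finite, simple and undirected. For vertices $u,v$ of a graph $G$, $d_G(u,v)$ is the number of edges of a shortest $(u,v)$-path. The eccentricity of a vertex $v$ of a connected graph is the distance from $v$ to a vertex farthest from $v$, and the radius of the graph is the minimum eccentricity among its vertices. A set $S \subseteq V(G)$ is a $k$-dominating set of $G$ if every vertex of $G$ is at distance at most $k$ in $G$ from some vertex of $S$. The $k$-domination number $\gamma_k(G)$ is the minimum cardinality of a $k$-dominating set of $G$. *)

(* Defs.v *)
From mathcomp Require Import all_boot all_order all_algebra.

Set Implicit Arguments.
Unset Strict Implicit.
Unset Printing Implicit Defensive.

(* A finite simple graph with vertex set T is a symmetric irreflexive adjacency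
   relation e : rel T. *)
Definition simple_graph (T : finType) (e : rel T) : Prop :=
  symmetric e /\ irreflexive e.

Definition connected_graph (T : finType) (e : rel T) : Prop :=
  0 < #|T| /\ forall u v : T, connect e u v.

(* The path visits the vertices u :: p, hence has size p = n edges. *)
Definition has_path (T : finType) (e : rel T) (u v : T) (n : nat) : bool :=
  [exists p : n.-tuple T, [&& path e u p, last u p == v & uniq (u :: p)]].

(* A path repeats no vertex, so it has fewer than #|T| edges: the bound on n
   excludes no path. The value is #|T| when u and v are not connected, so gdist
   and the notions built on it are meant for connected graphs. *)
Definition gdist (T : finType) (e : rel T) (u v : T) : nat :=
  \big[minn/#|T|]_(n < #|T| | has_path e u v n) n.

Definition eccentricity (T : finType) (e : rel T) (v : T) : nat :=
  \max_(u : T) gdist e v u.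

(* Eccentricities never exceed #|T|, so the default value is only relevant when
   T is empty. *)
Definition radius (T : finType) (e : rel T) : nat :=
  \big[minn/#|T|]_(v : T) eccentricity e v.

Definition k_dominating (T : finType) (e : rel T) (k : nat) (S : {set T}) : bool :=
  [forall v, exists s in S, gdist e v s <= k].

(* [set: T] is k-dominating and has cardinality #|T|, so the default value does
   not affect the minimum. *)
Definition k_domination_number (T : finType) (e : rel T) (k : nat) : nat :=
  \big[minn/#|T|]_(S : {set T} | k_dominating e k S) #|S|.

(* Main.v *)
(** Put [K = 2k+1] and let [S] be a [k]-dominating set. Connectivity lets one
    enumerate [S] so that every new vertex lies within [K] of an earlier one.
    Along this enumeration a centre of the vertices met so far is maintained:
    either one vertex [a] with all of them within [m K] of [a], once there are at
    least [2m+1] of them, or two vertices [a], [b] at distance at most [K] with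
    each of them within [m K] of [a] or of [b], once there are at least [2m+2].
    A new vertex moves the centre by half a step of length [K]. At the end,
    either [a] or a vertex halfway between [a] and [b] has eccentricity at most
    [#|S| K / 2]. *)
Require Import Defs.
From mathcomp Require Import all_boot all_order all_algebra.
From mathcomp Require Import zify.

Set Implicit Arguments.
Unset Strict Implicit.
Unset Printing Implicit Defensive.

Import GRing.Theory Num.Theory.

Section BigMinn.

Variables (I : finType) (x : nat) (P : pred I) (F : I -> nat).

Lemma bigminn_leq j : P j -> \big[minn/x]_(i | P i) F i <= F j.
Proof.
move=> Pj; have := mem_index_enum j; rewrite unlock.
elim: (index_enum I) => //= i s IHs; rewrite inE => /predU1P[<-|/IHs le_s].
  by rewrite Pj geq_minl.
by case: ifP => // _; apply: leq_trans le_s; apply: geq_minr.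
Qed.

(** The fold starts at [x], so [x] itself competes in the minimum; this is the first alternative. *)
Lemma bigminn_attained :
  \big[minn/x]_(i | P i) F i = x \/
  exists2 i, P i & \big[minn/x]_(i | P i) F i = F i.
Proof.
elim/big_rec: _ => [|i n Pi IHn]; first by left.
by rewrite /minn; case: ifP => _ //; right; exists i.
Qed.

End BigMinn.

Section Walks.

Variables (T : finType) (e : rel T).

(** Walks may repeat vertices and [n] is only an upper bound, so they can be concatenated, reversed
    and cut freely. *)
Definition within n (u v : T) : Prop :=
  exists p, [/\ path e u p, last u p = v & size p <= n].

Lemma within_refl n u : within n u u.
Proof. by exists [::]. Qed.

Lemma within_leq m n u v : m <= n -> within m u v -> within n u v.
Proof. by move=> le_mn [p [ep pv /leq_trans sp]]; exists p; rewrite sp. Qed.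

Lemma within_edge u v : e u v -> within 1 u v.
Proof. by move=> euv; exists [:: v]; rewrite /= euv. Qed.

Lemma within_trans m n u v w :
  within m u v -> within n v w -> within (m + n) u w.
Proof.
move=> [p [ep pv sp]] [q [eq qw sq]]; exists (p ++ q).
by rewrite cat_path last_cat size_cat ep pv eq qw leq_add.
Qed.

Lemma within_sym m u v : symmetric e -> within m u v -> within m v u.
Proof.
move=> e_sym [p [ep pv sp]]; exists (rev (belast u p)).
rewrite -{1}pv rev_path (eq_path (e' := e)) ?ep => [|y z]; last exact: e_sym.
rewrite size_rev size_belast sp; split=> //.
by case: (p) pv => //= y s _; rewrite rev_cons last_rcons.
Qed.

Lemma within_split m n u w :
  within (m + n) u w -> exists2 v, within m u v & within n v w.
Proof.
move=> [p [ep pw sp]]; exists (last u (take m p)).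
  exists (take m p); split=> //; last by rewrite size_take_min geq_minl.
  by move: ep; rewrite -{1}(cat_take_drop m p) cat_path => /andP[].
exists (drop m p); rewrite -last_cat cat_take_drop pw size_drop leq_subLR sp.
by move: ep; rewrite -{1}(cat_take_drop m p) cat_path => /andP[_ ->].
Qed.

(** Removing repetitions turns the walk into a path with fewer than [#|T|] edges, whose length is an
    admissible index of the minimum. *)
Lemma gdist_within n u v : within n u v -> gdist e u v <= n.
Proof.
move=> [p [ep pv sp]]; case/shortenP: ep pv => q eq uq sub_qp qv.
have size_q : size q < #|T|.
  by have := max_card [in u :: q]; rewrite (card_uniqP uq).
have size_qp : size q <= size p by apply: uniq_leq_size => //; case/andP: uq.
apply: leq_trans (leq_trans size_qp sp).
apply: (@bigminn_leq _ _ _ _ (Ordinal size_q)); apply/existsP.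
by exists (in_tuple q); rewrite /= eq qv eqxx; apply: uq.
Qed.

Lemma within_gdist u v : connect e u v -> within (gdist e u v) u v.
Proof.
move=> /connectP[p ep vp]; rewrite /gdist.
have [->|[n /existsP[q /and3P[eq /eqP qv _]] ->]] :=
  bigminn_attained #|T| (fun n : 'I_#|T| => has_path e u v n) (@nat_of_ord _).
  (* If the minimum is the default [#|T|], any repetition-free path is short enough. *)
  case/shortenP: ep vp => q eq uq _ qv; exists q; split=> //.
  by have := max_card [in u :: q]; rewrite (card_uniqP uq) => /ltnW.
by exists q; rewrite size_tuple.
Qed.

End Walks.

Section Centre.

Variables (T : finType) (e : rel T) (k : nat) (S : {set T}).
Hypothesis e_sym : symmetric e.
Hypothesis e_conn : forall u v, connect e u v.
Hypothesis S_dom : forall v, exists2 s, s \in S & within e k v s.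

Let K := 2 * k + 1.

Lemma dominating_grow (A : {set T}) : A != set0 -> A \proper S ->
  exists s t, [/\ s \in A, t \in S :\: A & within e K s t].
Proof.
move=> /set0Pn[s0 s0A] /properP[_ [t0 t0S t0A]].
have /connectP[p ep t0p] := e_conn s0 t0.
(* Invariant along a walk from [A] to [t0]: the current vertex is within [k] of [A]. The first step
   to a vertex [y] whose dominator [t] lies outside [A] gives [k + 1 + k = K]; failing that, [t0]
   itself serves. *)
have: exists2 s, s \in A & within e k s s0.
  by exists s0; last exact: within_refl.
elim: p {s0A} s0 ep t0p => [|y p IHp] x /=.
  move=> _ <- [s sA st0]; exists s, t0; rewrite inE t0A t0S; split=> //.
  by apply: within_leq st0; rewrite /K; lia.
move=> /andP[exy ep] t0p [s sA sx]; have [t tS yt] := S_dom y.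
have [tA|tA] := boolP (t \in A).
  by apply: (IHp y) => //; exists t => //; apply: within_sym.
exists s, t; rewrite inE tA tS; split=> //.
have -> : K = k + (1 + k) by rewrite /K; lia.
exact: within_trans sx (within_trans (within_edge exy) yt).
Qed.

Definition vertex_centred (A : {set T}) m a :=
  2 * m + 1 <= #|A| /\ forall s, s \in A -> within e (m * K) a s.

Definition pair_centred (A : {set T}) m a b :=
  [/\ 2 * m + 2 <= #|A|, within e K a b
    & forall s, s \in A -> within e (m * K) a s \/ within e (m * K) b s].

Definition centred A :=
  (exists m a, vertex_centred A m a) \/ (exists m a b, pair_centred A m a b).

Lemma centred_grow (A : {set T}) s t :
  centred A -> s \in A -> t \notin A -> within e K s t -> centred (t |: A).
Proof.
move=> cA sA tA st; have cardU : #|t |: A| = #|A|.+1 by rewrite cardsU1 tA.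
case: cA => [[m [a [Am Aa]]]|[m [a [b [Am ab Aab]]]]].
  (* Going through [s], [t] is within [m * K + K] of [a]; the vertex reached after [K] steps becomes
     the second centre. *)
  have [b ab bt] : exists2 b, within e K a b & within e (m * K) b t.
    by apply: within_split; rewrite addnC; apply: within_trans st; apply: Aa.
  right; exists m, a, b; split=> //; first by rewrite cardU; lia.
  by move=> x /setU1P[->|/Aa]; [right | left].
(* The centre on the side of [s] is kept: one more [K] reaches [t] through [s] and the other side
   through [b]. *)
left; wlog as_ : a b ab Aab / within e (m * K) a s => [IH|].
  have [as_|bs] := Aab s sA; first exact: (IH a b).
  by apply: (IH b a) => //; [apply: within_sym | move=> x /Aab[]; [right|left]].
exists m.+1, a; split; first by rewrite cardU; lia.
move=> x /setU1P[->|/Aab[ax|bx]].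
- by rewrite mulSn addnC; apply: within_trans st.
- by apply: within_leq ax; rewrite leq_mul2r leqnSn orbT.
- by rewrite mulSn; apply: within_trans ab bx.
Qed.

Lemma centred_dominating : S != set0 -> centred S.
Proof.
move=> S0; have [s0 s0S] := set0Pn _ S0.
suff grow n : n < #|S| ->
    exists A : {set T}, [/\ A \subset S, #|A| = n.+1 & centred A].
  have [|A [AS cardA cA]] := grow #|S|.-1; first by rewrite prednK ?card_gt0.
  suff <- : A = S by [].
  by apply/eqP; rewrite eqEcard AS cardA prednK ?card_gt0 ?leqnn.
elim: n => [_|n IHn ltnS].
  exists [set s0]; rewrite sub1set cards1; split=> //; left; exists 0, s0.
  by split=> [|s /set1P->]; [rewrite cards1 | apply: within_refl].
have [A [AS cardA cA]] := IHn (ltnW ltnS).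
have [||s [t [sA]]] := @dominating_grow A.
- by rewrite -card_gt0 cardA.
- by rewrite properEcard AS cardA.
rewrite inE => /andP[tA tS] st; exists (t |: A); split.
- by rewrite subUset sub1set tS.
- by rewrite cardsU1 tA cardA.
- exact: centred_grow st.
Qed.

Lemma dominating_radius : S != set0 -> 2 * radius e <= #|S| * K.
Proof.
have radius_within n x : (forall v, within e n x v) -> radius e <= n.
  move=> xn; apply: leq_trans (_ : eccentricity e x <= n).
    exact: bigminn_leq.
  by apply/bigmax_leqP => v _; apply: gdist_within.
move=> /centred_dominating[[m [a [Sm Sa]]]|[m [a [b [Sm ab Sab]]]]].
  (* Reaching a vertex from its dominator costs [k] more, and
     [2 * (m * K + k) = (2 * m + 1) * K - 1]. *)
  suff: radius e <= m * K + k.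
    have := leq_mul Sm (leqnn K); rewrite {2 4}/K; nia.
  apply: radius_within => v; have [s sS vs] := S_dom v.
  by apply: within_trans (Sa s sS) _; apply: within_sym.
(* As [K = k + k.+1], [x] is nearly a midpoint. The farther side gives
   [k.+1 + m * K + k = m.+1 * K], half of [(2 * m + 2) * K]. *)
have [x ax xb] : exists2 x, within e k a x & within e k.+1 x b.
  by apply: within_split; apply: within_leq ab; rewrite /K; lia.
suff: radius e <= m.+1 * K by have := leq_mul Sm (leqnn K); nia.
have -> : m.+1 * K = k.+1 + m * K + k by rewrite /K; lia.
apply: (radius_within _ x) => v; have [s sS vs] := S_dom v.
apply: within_trans (within_sym e_sym vs).
have [as_|bs] := Sab s sS; apply: within_trans; [|exact: as_| |exact: bs] => //.
by apply: (@within_leq _ _ k) => //; apply: within_sym.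
Qed.

End Centre.

Lemma k_domination_number_attained (T : finType) (e : rel T) k :
  exists2 S : {set T}, k_dominating e k S & k_domination_number e k = #|S|.
Proof.
rewrite /k_domination_number.
have [->|//] := bigminn_attained #|T| (k_dominating e k) (fun S => #|S|).
exists [set: T]; last by rewrite cardsT.
apply/forallP => v; apply/existsP; exists v; rewrite inE.
by apply: gdist_within; apply: within_refl.
Qed.

Local Open Scope ring_scope.

Theorem corollary10 (T : finType) (e : rel T) (k r : nat)
    (hk : (1 <= k)%N)
    (he : simple_graph e)
    (hconn : connected_graph e)
    (hr : radius e = r) :
  (2 * r%:R) / (2 * k%:R + 1) <= (k_domination_number e k)%:R :> rat.
Proof.
case: he hconn => e_sym _ [/card_gt0P[v0 _] e_conn].
have [S /forallP S_dom ->] := k_domination_number_attained e k.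
have S_within v : exists2 s, s \in S & within e k v s.
  have /existsP[s /andP[sS vs]] := S_dom v; exists s => //.
  exact: within_leq vs (within_gdist (e_conn v s)).
have S0 : S != set0 by have [s sS _] := S_within v0; apply/set0Pn; exists s.
have := dominating_radius e_sym e_conn S_within S0; rewrite hr => le_r.
have -> : 2 * k%:R + 1 = (2 * k + 1)%N%:R :> rat by rewrite natrD natrM.
rewrite ler_pdivrMr; last by rewrite ltr0n addn1.
by rewrite -!natrM ler_nat.
Qed.
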